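(* In a monoidal setting for dynamic stability, assume that the unit clock $1_T$ is $T$-complete and that for every $T$-flow $\phi$ the system $\mathrm D\phi$ has the uniqueness property. Then the functor $\mathcal L$, which takes values in $T$-complete systems, is left adjoint to the forgetful functor $U\colon T\text{-}\mathsf{Sys}_{\mathcal F}\to\mathcal C$, and this adjunction is monadic (the canonical comparison functor from $T\text{-}\mathsf{Sys}_{\mathcal F}$ to the Eilenberg–Moore category of the induced monad on $\mathcal C$ is an equivalence).
   Context: Conventions. $\mathcal C$ is a category with all finite products and terminal object $1$; $!\colon X\to 1$ is the unique map; $\langle a,b\rangle$ denotes pairing; $\pi$ denotes a product projection. $\mathcal F\colon\mathcal C\to\mathcal C$ is an endofunctor. An $\mathcal F$-system is a morphism $f\colon X\to\mathcal FX$; a morphism of $\mathcal F$-systems from $f\colon X\to\mathcal FX$ to $g\colon Y\to\mathcal FY$ is $p\colon X\to Y$ with $\mathcal Fp\circ f=g\circ p$; these form the category $\mathsf{Sys}_{\mathcal F}$. An object $R$ is posetal if every hom-set $\mathcal C(A,R)$ carries a partial order $\le$ such that precomposition with any $A'\to A$ is order-preserving. Monoidal setting for dynamic stability. It consists of: an object $E$; a monoid object $(T,\oplus,0_\oplus)$; a posetal object $R$ with a point $o_R\colon 1\to R$; a morphism $d\colon E\times E\to R$ with $d\ge o_R\circ !$ and such that the diagonal $\Delta\colon E\to E\times E$ is the equalizer of $d$ and $o_R\circ !$; an $\mathcal F$-system $1_T\colon T\to\mathcal FT$ (unit clock); a posetal structure on $\mathcal FR$; a natural transformation $\psi_{A,B}\colon\mathcal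 FA\times\mathcal FB\to\mathcal F(A\times B)$ that is associative, i.e. $\mathcal F\alpha_{X,Y,Z}\circ\psi_{X\times Y,Z}\circ(\psi_{X,Y}\times\mathrm{id})=\psi_{X,Y\times Z}\circ(\mathrm{id}\times\psi_{Y,Z})\circ\alpha_{\mathcal FX,\mathcal FY,\mathcal FZ}$ with $\alpha$ the associativity isomorphism of products; a natural transformation $0_A\colon A\to\mathcal FA$ (stationary systems) with $\psi_{A,B}\circ(0_A\times 0_B)=0_{A\times B}$; the stable system on $R$ is $\sigma=0_R\colon R\to\mathcal FR$. For an object $X$ put $\mathcal L_X:=\psi_{T,X}\circ(1_T\times 0_X)\colon T\times X\to\mathcal F(T\times X)$; this defines a functor $\mathcal L\colon\mathcal C\to\mathsf{Sys}_{\mathcal F}$, $X\mapsto(T\times X,\mathcal L_X)$, $h\mapsto\mathrm{id}_T\times h$. These data are subject to the comparison axioms: (D4) for every $\gamma\colon T\to R$, $\mathcal F\gamma\circ 1_T\le\sigma\circ\gamma$ implies $\gamma\le\gamma\circ 0_\oplus\circ !$; (D4') for every object $A$ and every $\gamma\colon T\times A\to R$, $\mathcal F\gamma\circ\mathcal L_A\le 0_R\circ\gamma$ implies $\gamma\le\gamma\circ\langle 0_\oplus\circ !,\mathrm{id}_A\rangle\circ\pi_A$. $T$-completeness. A system $f_A\colon A\to\mathcal FA$ is $T$-complete if for every object $B$ and every $g\colon B\to A$ there is a unique morphism of systems $\gamma\colon(T\times B,\mathcal L_B)\to(A,f_A)$ with $\gamma\circ\langle 0_\oplus\circ !,\mathrm{id}_B\rangle=g$.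 $T\text{-}\mathsf{Sys}_{\mathcal F}$ is the full subcategory of $\mathsf{Sys}_{\mathcal F}$ on $T$-complete systems; $U$ sends $(X,f)$ to $X$. When $1_T$ is $T$-complete, there is a unique monoid structure on $T$ with unit $0_\oplus$ whose multiplication is a morphism of systems $\mathcal L_T\to 1_T$; the multiplication $\oplus$ is understood to be this one. Uniqueness property. A system $f_X\colon X\to\mathcal FX$ has the uniqueness property if for every object $B$, any two morphisms of systems $\gamma_1,\gamma_2\colon\mathcal L_B\to f_X$ with $\gamma_1\circ\langle 0_\oplus\circ !,\mathrm{id}_B\rangle=\gamma_2\circ\langle 0_\oplus\circ !,\mathrm{id}_B\rangle$ are equal. Flows. A $T$-flow on an object $X$ is a monoid action $\phi\colon T\times X\to X$: $\phi\circ\langle 0_\oplus\circ !,\mathrm{id}_X\rangle=\mathrm{id}_X$ and $\phi\circ(\oplus\times\mathrm{id}_X)=\phi\circ(\mathrm{id}_T\times\phi)$. Its derivative is $\mathrm D\phi:=\mathcal F\phi\circ\mathcal L_X\circ\langle 0_\oplus\circ !,\mathrm{id}_X\rangle\colon X\to\mathcal FX$. *)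

(* Defs.v *)
From Stdlib Require Import ProofIrrelevance Program.Tactics.

Set Implicit Arguments.
Unset Strict Implicit.
Unset Printing Implicit Defensive.

Declare Scope cat_scope.
Delimit Scope cat_scope with cat.
Local Open Scope cat_scope.

Record Category := {
  Ob :> Type;
  Hom : Ob -> Ob -> Type;
  idm : forall X, Hom X X;
  comp : forall X Y Z, Hom Y Z -> Hom X Y -> Hom X Z;
  comp_idl : forall X Y (f : Hom X Y), comp (idm Y) f = f;
  comp_idr : forall X Y (f : Hom X Y), comp f (idm X) = f;
  comp_assoc : forall X Y Z W (h : Hom Z W) (g : Hom Y Z) (f : Hom X Y),
    comp (comp h g) f = comp h (comp g f)
}.
Arguments Hom {c} X Y.
Arguments idm {c} X.
Arguments comp {c X Y Z} g f.

Notation "g ∘ f" := (comp g f) (at level 40, left associativity) : cat_scope.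

Definition is_iso (C : Category) (X Y : C) (f : Hom X Y) : Prop :=
  exists g : Hom Y X, g ∘ f = idm X /\ f ∘ g = idm Y.

Definition is_equalizer (C : Category) (X Y Z : C)
    (e : Hom X Y) (f g : Hom Y Z) : Prop :=
  f ∘ e = g ∘ e /\
  forall (W : C) (h : Hom W Y), f ∘ h = g ∘ h -> exists! k : Hom W X, e ∘ k = h.

Record Functor (C D : Category) := {
  fobj :> C -> D;
  fmap : forall X Y : C, Hom X Y -> Hom (fobj X) (fobj Y);
  fmap_id : forall X, fmap (idm X) = idm (fobj X);
  fmap_comp : forall X Y Z (g : Hom Y Z) (f : Hom X Y),
    fmap (g ∘ f) = fmap g ∘ fmap f
}.
Arguments fmap {C D} F {X Y} f : rename.

Definition Fid (C : Category) : Functor C C :=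
  {| fobj := fun X : C => X;
     fmap := fun X Y f => f;
     fmap_id := fun X => eq_refl;
     fmap_comp := fun X Y Z g f => eq_refl |}.

Program Definition Fcomp (C D E : Category) (G : Functor D E) (F : Functor C D) :
    Functor C E :=
  {| fobj := fun X => G (F X);
     fmap := fun X Y f => fmap G (fmap F f) |}.
Next Obligation. now rewrite !fmap_id. Qed.
Next Obligation. now rewrite !fmap_comp. Qed.

Record NatTrans (C D : Category) (F G : Functor C D) := {
  component :> forall X : C, Hom (F X) (G X);
  naturality : forall (X Y : C) (f : Hom X Y),
    fmap G f ∘ component X = component Y ∘ fmap F f
}.

Definition is_equivalence (C D : Category) (F : Functor C D) : Prop :=
  exists (G : Functor D C)
         (u : NatTrans (Fid C) (Fcomp G F)) (v : NatTrans (Fcomp F G) (Fid D)),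
    (forall X : C, is_iso (u X)) /\ (forall Y : D, is_iso (v Y)).

Section FullSubcategory.
Variables (D : Category) (P : D -> Prop).

Definition FullSub : Category :=
  {| Ob := {X : D | P X};
     Hom := fun X Y => Hom (proj1_sig X) (proj1_sig Y);
     idm := fun X => idm (proj1_sig X);
     comp := fun X Y Z g f => g ∘ f;
     comp_idl := fun X Y f => comp_idl f;
     comp_idr := fun X Y f => comp_idr f;
     comp_assoc := fun X Y Z W h g f => comp_assoc h g f |}.

Definition inclusion : Functor FullSub D :=
  {| fobj := fun X : FullSub => proj1_sig X;
     fmap := fun X Y f => f;
     fmap_id := fun X => eq_refl;
     fmap_comp := fun X Y Z g f => eq_refl |}.

Definition corestrict (C : Category) (F : Functor C D) (hF : forall X, P (F X)) :
    Functor C FullSub :=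
  {| fobj := fun X => (exist P (F X) (hF X) : FullSub);
     fmap := fun X Y f => fmap F f;
     fmap_id := fun X => fmap_id F X;
     fmap_comp := fun X Y Z g f => fmap_comp F g f |}.

End FullSubcategory.

Record Monad (C : Category) := {
  mfun :> Functor C C;
  munit : NatTrans (Fid C) mfun;
  mmul : NatTrans (Fcomp mfun mfun) mfun;
  mmul_unitl : forall X, mmul X ∘ munit (mfun X) = idm (mfun X);
  mmul_unitr : forall X, mmul X ∘ fmap mfun (munit X) = idm (mfun X);
  mmul_assoc : forall X, mmul X ∘ mmul (mfun X) = mmul X ∘ fmap mfun (mmul X)
}.

Section EilenbergMoore.
Variables (C : Category) (M : Monad C).

Record Algebra := {
  alg_ob : C;
  alg_act : Hom (M alg_ob) alg_ob;
  alg_unit : alg_act ∘ munit M alg_ob = idm alg_ob;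
  alg_mul : alg_act ∘ mmul M alg_ob = alg_act ∘ fmap M alg_act
}.

Record AlgMor (a b : Algebra) := {
  am_mor : Hom (alg_ob a) (alg_ob b);
  am_comm : am_mor ∘ alg_act a = alg_act b ∘ fmap M am_mor
}.

Lemma AlgMor_eq (a b : Algebra) (f g : AlgMor a b) : am_mor f = am_mor g -> f = g.
Proof.
destruct f as [f hf], g as [g hg]; simpl; intros e; subst g.
now rewrite (proof_irrelevance _ hf hg).
Qed.

Program Definition AlgMor_id (a : Algebra) : AlgMor a a :=
  {| am_mor := idm (alg_ob a) |}.
Next Obligation. now rewrite fmap_id, comp_idl, comp_idr. Qed.

Program Definition AlgMor_comp (a b c : Algebra) (g : AlgMor b c) (f : AlgMor a b) :
    AlgMor a c :=
  {| am_mor := am_mor g ∘ am_mor f |}.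
Next Obligation.
now rewrite fmap_comp, comp_assoc, am_comm, <- comp_assoc, am_comm, comp_assoc.
Qed.

Program Definition EilenbergMoore : Category :=
  {| Ob := Algebra; Hom := AlgMor; idm := AlgMor_id; comp := AlgMor_comp |}.
Next Obligation. apply AlgMor_eq, comp_idl. Qed.
Next Obligation. apply AlgMor_eq, comp_idr. Qed.
Next Obligation. apply AlgMor_eq, comp_assoc. Qed.

End EilenbergMoore.

Record Adjunction (C D : Category) (L : Functor C D) (U : Functor D C) := {
  adj_unit : NatTrans (Fid C) (Fcomp U L);
  adj_counit : NatTrans (Fcomp L U) (Fid D);
  adj_triL : forall X : C, adj_counit (L X) ∘ fmap L (adj_unit X) = idm (L X);
  adj_triR : forall Y : D, fmap U (adj_counit Y) ∘ adj_unit (U Y) = idm (U Y)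
}.

Section Monadicity.
Variables (C D : Category) (L : Functor C D) (U : Functor D C).
Variable adj : Adjunction L U.

Program Definition adj_mul :
    NatTrans (Fcomp (Fcomp U L) (Fcomp U L)) (Fcomp U L) :=
  {| component := fun X => fmap U (adj_counit adj (L X)) |}.
Next Obligation.
rewrite <- !fmap_comp; f_equal; exact (naturality (adj_counit adj) (fmap L f)).
Qed.

Program Definition adj_monad : Monad C :=
  {| mfun := Fcomp U L; munit := adj_unit adj; mmul := adj_mul |}.
Next Obligation. exact (adj_triR adj (L X)). Qed.
Next Obligation.
rewrite <- fmap_comp, <- fmap_id; f_equal; exact (adj_triL adj X).
Qed.
Next Obligation.
rewrite <- !fmap_comp; f_equal.
exact (naturality (adj_counit adj) (adj_counit adj (L X))).
Qed.

Program Definition comparison_ob (Y : D) : EilenbergMoore adj_monad :=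
  {| alg_ob := U Y; alg_act := fmap U (adj_counit adj Y) |}.
Next Obligation. exact (adj_triR adj Y). Qed.
Next Obligation.
rewrite <- !fmap_comp; f_equal.
exact (naturality (adj_counit adj) (adj_counit adj Y)).
Qed.

Program Definition comparison_mor (Y Z : D) (f : Hom Y Z) :
    Hom (comparison_ob Y) (comparison_ob Z) :=
  {| am_mor := fmap U f |}.
Next Obligation.
rewrite <- !fmap_comp; f_equal; exact (naturality (adj_counit adj) f).
Qed.

Program Definition comparison : Functor D (EilenbergMoore adj_monad) :=
  {| fobj := comparison_ob; fmap := comparison_mor |}.
Next Obligation. apply AlgMor_eq, fmap_id. Qed.
Next Obligation. apply AlgMor_eq, fmap_comp. Qed.

Definition monadic : Prop := is_equivalence comparison.

End Monadicity.

Class FiniteProducts (C : Category) := {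
  one : C;
  bang : forall X, Hom X one;
  bang_unique : forall X (f : Hom X one), f = bang X;
  prod : C -> C -> C;
  pr1 : forall X Y, Hom (prod X Y) X;
  pr2 : forall X Y, Hom (prod X Y) Y;
  pair : forall A X Y, Hom A X -> Hom A Y -> Hom A (prod X Y);
  pr1_pair : forall A X Y (f : Hom A X) (g : Hom A Y), pr1 X Y ∘ pair f g = f;
  pr2_pair : forall A X Y (f : Hom A X) (g : Hom A Y), pr2 X Y ∘ pair f g = g;
  pair_eta : forall A X Y (h : Hom A (prod X Y)),
    pair (pr1 X Y ∘ h) (pr2 X Y ∘ h) = h
}.
Arguments bang {C _} X.
Arguments pr1 {C _ X Y}.
Arguments pr2 {C _ X Y}.
Arguments pair {C _ A X Y} f g.

Notation "X × Y" := (prod X Y) (at level 40, left associativity) : cat_scope.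
Notation "⟨ f , g ⟩" := (pair f g) (at level 0, f at level 99, g at level 99)
  : cat_scope.

Section Products.
Context (C : Category) {FP : FiniteProducts C}.

Definition prod_map (X X' Y Y' : C) (f : Hom X X') (g : Hom Y Y') :
    Hom (X × Y) (X' × Y') := ⟨f ∘ pr1, g ∘ pr2⟩.

Definition diag (X : C) : Hom X (X × X) := ⟨idm X, idm X⟩.

Definition assoc (X Y Z : C) : Hom (X × Y × Z) (X × (Y × Z)) :=
  ⟨pr1 ∘ pr1, ⟨pr2 ∘ pr1, pr2⟩⟩.

End Products.
Arguments assoc {C FP} X Y Z.

Notation "f ⊗ g" := (prod_map f g) (at level 38, left associativity) : cat_scope.

Record Posetal (C : Category) (R : C) := {
  ple : forall A : C, Hom A R -> Hom A R -> Prop;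
  ple_refl : forall A (f : Hom A R), ple f f;
  ple_trans : forall A (f g h : Hom A R), ple f g -> ple g h -> ple f h;
  ple_antisym : forall A (f g : Hom A R), ple f g -> ple g f -> f = g;
  ple_precomp : forall A A' (k : Hom A' A) (f g : Hom A R),
    ple f g -> ple (f ∘ k) (g ∘ k)
}.

Record MonoidObj (C : Category) {FP : FiniteProducts C} (T : C) := {
  mon_mul : Hom (T × T) T;
  mon_one : Hom one T;
  mon_unitl : mon_mul ∘ ⟨mon_one ∘ bang T, idm T⟩ = idm T;
  mon_unitr : mon_mul ∘ ⟨idm T, mon_one ∘ bang T⟩ = idm T;
  mon_assoc : mon_mul ∘ mon_mul ⊗ idm T
              = mon_mul ∘ idm T ⊗ mon_mul ∘ assoc T T T
}.

Section Systems.
Variables (C : Category) (F : Functor C C).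

Record System := {
  carrier : C;
  dyn : Hom carrier (F carrier)
}.

Record SysMor (f g : System) := {
  sys_mor : Hom (carrier f) (carrier g);
  sys_comm : fmap F sys_mor ∘ dyn f = dyn g ∘ sys_mor
}.

Lemma SysMor_eq (f g : System) (p q : SysMor f g) : sys_mor p = sys_mor q -> p = q.
Proof.
destruct p as [p hp], q as [q hq]; simpl; intros e; subst q.
now rewrite (proof_irrelevance _ hp hq).
Qed.

Program Definition SysMor_id (f : System) : SysMor f f :=
  {| sys_mor := idm (carrier f) |}.
Next Obligation. now rewrite fmap_id, comp_idl, comp_idr. Qed.

Program Definition SysMor_comp (f g h : System) (q : SysMor g h) (p : SysMor f g) :
    SysMor f h :=
  {| sys_mor := sys_mor q ∘ sys_mor p |}.
Next Obligation.
now rewrite fmap_comp, comp_assoc, sys_comm, <- comp_assoc, sys_comm, comp_assoc.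
Qed.

Program Definition Sys : Category :=
  {| Ob := System; Hom := SysMor; idm := SysMor_id; comp := SysMor_comp |}.
Next Obligation. apply SysMor_eq, comp_idl. Qed.
Next Obligation. apply SysMor_eq, comp_idr. Qed.
Next Obligation. apply SysMor_eq, comp_assoc. Qed.

Definition forget : Functor Sys C :=
  {| fobj := fun f : Sys => carrier f;
     fmap := fun f g p => sys_mor p;
     fmap_id := fun f => eq_refl;
     fmap_comp := fun f g h q p => eq_refl |}.

End Systems.

(** [clock] is the unit clock 1_T and [stat] the transformation 0; the stable
    system sigma on [R] is [stat R], and [psi T A ∘ clock ⊗ stat A] in the last
    axiom is [Ldyn A] below. *)
Record MonoidalSetting (C : Category) {FP : FiniteProducts C} (F : Functor C C) := {
  E : C;
  T : C;
  T_mon : MonoidObj T;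
  R : C;
  R_pos : Posetal R;
  o_R : Hom one R;
  dist : Hom (E × E) R;
  dist_ge : ple R_pos (o_R ∘ bang (E × E)) dist;
  dist_eq : is_equalizer (diag E) dist (o_R ∘ bang (E × E));
  clock : Hom T (F T);
  FR_pos : Posetal (F R);
  psi : forall A B : C, Hom (F A × F B) (F (A × B));
  psi_nat : forall (A A' B B' : C) (f : Hom A A') (g : Hom B B'),
    fmap F (f ⊗ g) ∘ psi A B = psi A' B' ∘ fmap F f ⊗ fmap F g;
  psi_assoc : forall X Y Z : C,
    fmap F (assoc X Y Z) ∘ psi (X × Y) Z ∘ psi X Y ⊗ idm (F Z)
    = psi X (Y × Z) ∘ idm (F X) ⊗ psi Y Z ∘ assoc (F X) (F Y) (F Z);
  stat : forall A : C, Hom A (F A);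
  stat_nat : forall (A B : C) (f : Hom A B), fmap F f ∘ stat A = stat B ∘ f;
  psi_stat : forall A B : C, psi A B ∘ stat A ⊗ stat B = stat (A × B);
  axiom_D4 : forall gamma : Hom T R,
    ple FR_pos (fmap F gamma ∘ clock) (stat R ∘ gamma) ->
    ple R_pos gamma (gamma ∘ mon_one T_mon ∘ bang T);
  axiom_D4' : forall (A : C) (gamma : Hom (T × A) R),
    ple FR_pos (fmap F gamma ∘ (psi T A ∘ clock ⊗ stat A)) (stat R ∘ gamma) ->
    ple R_pos gamma (gamma ∘ ⟨mon_one T_mon ∘ bang A, idm A⟩ ∘ pr2)
}.

Section Setting.
Context (C : Category) {FP : FiniteProducts C} (F : Functor C C).
Variable S : MonoidalSetting F.

Local Notation T := (T S).
Local Notation mul := (mon_mul (T_mon S)).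
Local Notation zero := (mon_one (T_mon S)).

Definition unit_clock : Sys F := {| carrier := T; dyn := clock S |}.

Definition Ldyn (X : C) : Hom (T × X) (F (T × X)) :=
  psi S T X ∘ clock S ⊗ stat S X.

Definition Lsys (X : C) : Sys F := {| carrier := T × X; dyn := Ldyn X |}.

Lemma prod_map_comp (A A' A'' B B' B'' : C) (f' : Hom A' A'') (f : Hom A A')
    (g' : Hom B' B'') (g : Hom B B') :
  (f' ⊗ g') ∘ (f ⊗ g) = (f' ∘ f) ⊗ (g' ∘ g).
Proof.
unfold prod_map.
rewrite <- (pair_eta (⟨f' ∘ pr1, g' ∘ pr2⟩ ∘ ⟨f ∘ pr1, g ∘ pr2⟩)).
rewrite <- !comp_assoc, pr1_pair, pr2_pair, !comp_assoc.
now rewrite pr1_pair, pr2_pair.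
Qed.

Lemma prod_map_id (A B : C) : idm A ⊗ idm B = idm (A × B).
Proof.
unfold prod_map; rewrite !comp_idl.
now rewrite <- (pair_eta (idm (A × B))), !comp_idr.
Qed.

Program Definition Lmor (X Y : C) (h : Hom X Y) : Hom (Lsys X) (Lsys Y) :=
  {| sys_mor := idm T ⊗ h |}.
Next Obligation.
unfold Ldyn.
rewrite <- comp_assoc, psi_nat, !comp_assoc, !prod_map_comp.
now rewrite fmap_id, comp_idl, comp_idr, stat_nat.
Qed.

Program Definition Lfun : Functor C (Sys F) := {| fobj := Lsys; fmap := Lmor |}.
Next Obligation. apply SysMor_eq, prod_map_id. Qed.
Next Obligation.
apply SysMor_eq; simpl; now rewrite prod_map_comp, comp_idl.
Qed.

Definition at_zero (B : C) : Hom B (T × B) := ⟨zero ∘ bang B, idm B⟩.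

Definition T_complete (f : Sys F) : Prop :=
  forall (B : C) (g : Hom B (carrier f)),
    exists! gamma : Hom (Lsys B) f, sys_mor gamma ∘ at_zero B = g.

Definition TSys : Category := FullSub T_complete.

Definition forgetT : Functor TSys C := Fcomp (forget F) (inclusion T_complete).

Definition uniqueness_property (f : Sys F) : Prop :=
  forall (B : C) (gamma1 gamma2 : Hom (Lsys B) f),
    sys_mor gamma1 ∘ at_zero B = sys_mor gamma2 ∘ at_zero B -> gamma1 = gamma2.

Definition is_flow (X : C) (phi : Hom (T × X) X) : Prop :=
  phi ∘ at_zero X = idm X /\
  phi ∘ mul ⊗ idm X = phi ∘ idm T ⊗ phi ∘ assoc T T X.

Definition flow_deriv (X : C) (phi : Hom (T × X) X) : Sys F :=
  {| carrier := X; dyn := fmap F phi ∘ Ldyn X ∘ at_zero X |}.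

(** When the clock is [T]-complete, [mul] is by convention the unique monoid
    multiplication with unit [zero] that is a morphism of systems from
    [Lsys T] to the clock; uniqueness makes this the whole content. *)
Definition mul_is_system_morphism : Prop :=
  fmap F mul ∘ dyn (Lsys T) = dyn unit_clock ∘ mul.

End Setting.

(* Main.v *)
(** Translation in the first variable, [(s, (t, x)) ↦ (s ⊕ t, x)], is a flow on
    [T × X] and a morphism of systems [L (T × X) -> L X]; hence its derivative is
    [L X], and the hypothesis on derivatives of flows makes [L X] [T]-complete.
    The counit of the adjunction sends a [T]-complete system to the solution
    through the identity, so that the multiplication of the induced monad is
    translation and the algebras are exactly the flows.  A flow is itself the
    solution through the identity of its derivative, so differentiation is
    inverse to the comparison functor. *)
From Stdlib Require Import IndefiniteDescription.
Require Import Defs.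

Set Implicit Arguments.
Unset Strict Implicit.
Unset Printing Implicit Defensive.
Local Open Scope cat_scope.

(** * Calculus of pairings *)

Section ProductLemmas.
Context (C : Category) {FP : FiniteProducts C}.

Lemma pair_comp (A B X Y : C) (f : Hom A X) (g : Hom A Y) (h : Hom B A) :
  ⟨f, g⟩ ∘ h = ⟨f ∘ h, g ∘ h⟩.
Proof.
rewrite <- (pair_eta (⟨f, g⟩ ∘ h)), <- !comp_assoc.
now rewrite pr1_pair, pr2_pair.
Qed.

(** Once composites are associated to the right, [pr1_pair] no longer matches inside a longer
    composite; this form lets [prod_norm] project there. *)
Lemma pr1_pair_comp (A B X Y : C) (f : Hom A X) (g : Hom A Y) (h : Hom B A) :
  pr1 ∘ (⟨f, g⟩ ∘ h) = f ∘ h.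
Proof. now rewrite <- comp_assoc, pr1_pair. Qed.

Lemma pr2_pair_comp (A B X Y : C) (f : Hom A X) (g : Hom A Y) (h : Hom B A) :
  pr2 ∘ (⟨f, g⟩ ∘ h) = g ∘ h.
Proof. now rewrite <- comp_assoc, pr2_pair. Qed.

Lemma pair_pr (X Y : C) : ⟨pr1, pr2⟩ = idm (X × Y).
Proof. now rewrite <- (pair_eta (idm (X × Y))), !comp_idr. Qed.

Lemma bang_comp (X Y : C) (f : Hom X Y) : bang Y ∘ f = bang X.
Proof. apply bang_unique. Qed.

Definition assoc_inv (X Y Z : C) : Hom (X × (Y × Z)) (X × Y × Z) :=
  ⟨⟨pr1, pr1 ∘ pr2⟩, pr2 ∘ pr2⟩.

End ProductLemmas.

Ltac prod_norm :=
  repeat progress (unfold prod_map, assoc, assoc_inv, at_zero;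
    rewrite ?comp_assoc, ?pair_comp, ?pr1_pair, ?pr2_pair, ?pr1_pair_comp,
      ?pr2_pair_comp, ?comp_idl, ?comp_idr, ?pair_pr, ?pair_eta, ?bang_comp).

Section ProductIdentities.
Context (C : Category) {FP : FiniteProducts C}.

Lemma assoc_invK (X Y Z : C) : assoc X Y Z ∘ assoc_inv X Y Z = idm _.
Proof. now prod_norm. Qed.

Lemma assoc_nat (X X' Y Y' Z Z' : C) (f : Hom X X') (g : Hom Y Y') (h : Hom Z Z') :
  assoc X' Y' Z' ∘ (f ⊗ g) ⊗ h = f ⊗ (g ⊗ h) ∘ assoc X Y Z.
Proof. now prod_norm. Qed.

Context (M : C) (m : MonoidObj M).

Lemma mon_mul_zerol (A : C) (f : Hom A M) :
  mon_mul m ∘ ⟨mon_one m ∘ bang A, f⟩ = f.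
Proof.
rewrite <- (comp_idl f) at 2; rewrite <- (mon_unitl m).
now prod_norm.
Qed.

Lemma mon_mul_assoc (A : C) (f g h : Hom A M) :
  mon_mul m ∘ ⟨mon_mul m ∘ ⟨f, g⟩, h⟩ = mon_mul m ∘ ⟨f, mon_mul m ∘ ⟨g, h⟩⟩.
Proof.
pose proof (f_equal (fun k => k ∘ ⟨⟨f, g⟩, h⟩) (mon_assoc m)) as e.
revert e; cbv beta; prod_norm; trivial.
Qed.

End ProductIdentities.

(** * Free systems and translation in time *)

Section Setting.
Context (C : Category) {FP : FiniteProducts C} (F : Functor C C).
Context (S : MonoidalSetting F).

Local Notation T := (T S).
Local Notation mul := (mon_mul (T_mon S)).
Local Notation zero := (mon_one (T_mon S)).

Lemma at_zero_nat (X Y : C) (h : Hom X Y) :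
  idm T ⊗ h ∘ at_zero S X = at_zero S Y ∘ h.
Proof. now prod_norm. Qed.

Lemma Ldyn_nat (X Y : C) (h : Hom X Y) :
  fmap F (idm T ⊗ h) ∘ Ldyn S X = Ldyn S Y ∘ idm T ⊗ h.
Proof. exact (sys_comm (Lmor S h)). Qed.

Definition translation (X : C) : Hom (T × (T × X)) (T × X) :=
  mul ⊗ idm X ∘ assoc_inv T T X.

Lemma translation_at_zero (X : C) : translation X ∘ at_zero S (T × X) = idm (T × X).
Proof.
unfold translation; prod_norm.
now rewrite mon_mul_zerol, pair_pr.
Qed.

Lemma translation_is_flow (X : C) : is_flow (translation X).
Proof.
split; [apply translation_at_zero|].
unfold translation; prod_norm.
now rewrite <- mon_mul_assoc, pair_eta.
Qed.

(** The stationary system on [T × X] splits through [psi], so associativity of [psi] groups the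
    stationary inner time with the clock. This exposes [Ldyn S T], the dynamics on the domain of
    [mul]. *)
Lemma Ldyn_assoc (X : C) :
  Ldyn S (T × X) ∘ assoc T T X
  = fmap F (assoc T T X) ∘ (psi S (T × T) X ∘ Ldyn S T ⊗ stat S X).
Proof.
transitivity (psi S T (T × X) ∘ idm (F T) ⊗ psi S T X ∘ assoc (F T) (F T) (F X)
              ∘ (clock S ⊗ stat S T) ⊗ stat S X).
- rewrite (comp_assoc _ (assoc _ _ _)), assoc_nat.
  rewrite <- comp_assoc, (comp_assoc _ _ (clock S ⊗ _)).
  now rewrite prod_map_comp, psi_stat, comp_idl.
- rewrite <- psi_assoc, !comp_assoc, prod_map_comp.
  now rewrite comp_idl.
Qed.

(** After regrouping, naturality of [psi] separates the factors: on times the claim is [mul_mor], on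
    [X] it is trivial. *)
Lemma translation_comm (mul_mor : mul_is_system_morphism S) (X : C) :
  fmap F (translation X) ∘ Ldyn S (T × X) = Ldyn S X ∘ translation X.
Proof.
(* An identity is expanded as [assoc ∘ assoc_inv] to reach the shape of [Ldyn_assoc]. *)
rewrite <- (comp_idr (Ldyn S (T × X))), <- assoc_invK, <- (comp_assoc (Ldyn S _)).
rewrite Ldyn_assoc; unfold translation.
rewrite <- !comp_assoc; f_equal.
rewrite <- fmap_comp, (comp_assoc _ (assoc_inv _ _ _)).
replace (assoc_inv T T X ∘ assoc T T X) with (idm (T × T × X)).
2: { now prod_norm. }
rewrite comp_idr, psi_nat, comp_assoc, prod_map_comp.
unfold Ldyn at 2; rewrite comp_assoc, prod_map_comp.
change (Ldyn S T) with (dyn (Lsys S T)); rewrite mul_mor.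
now rewrite fmap_id, comp_idl, comp_idr.
Qed.

(** * Derivatives of flows and completeness *)

Lemma dyn_flow_deriv (f : Sys F) (phi : Hom (Lsys S (carrier f)) f) :
  sys_mor phi ∘ at_zero S (carrier f) = idm (carrier f) ->
  dyn (flow_deriv (sys_mor phi)) = dyn f.
Proof.
intros e.
(* The square of [phi] is restricted to time zero, where [phi] becomes the identity. *)
transitivity (dyn f ∘ sys_mor phi ∘ at_zero S (carrier f)).
- exact (f_equal (fun k => k ∘ at_zero S (carrier f)) (sys_comm phi)).
- now rewrite comp_assoc, e, comp_idr.
Qed.

Lemma flow_deriv_eq (f : Sys F) (phi : Hom (Lsys S (carrier f)) f) :
  sys_mor phi ∘ at_zero S (carrier f) = idm (carrier f) ->
  flow_deriv (sys_mor phi) = f.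
Proof.
intros e; pose proof (dyn_flow_deriv e) as d.
destruct f as [X dX]; exact (f_equal (Build_System (carrier := X)) d).
Qed.

(** One solution through the identity suffices for existence: precomposed with [Lmor S g] it passes
    through [g], since evaluation at zero is natural. *)
Lemma T_complete_of_solution (f : Sys F) (phi : Hom (Lsys S (carrier f)) f) :
  sys_mor phi ∘ at_zero S (carrier f) = idm (carrier f) ->
  uniqueness_property S f -> T_complete S f.
Proof.
simpl; intros e u B g; exists (phi ∘ Lmor S g); split.
- simpl; now rewrite comp_assoc, at_zero_nat, <- comp_assoc, e, comp_idl.
- intros gamma eg; apply u.
  rewrite eg; simpl; now rewrite comp_assoc, at_zero_nat, <- comp_assoc, e, comp_idl.
Qed.

Context (mul_mor : mul_is_system_morphism S).

(** The derivative only records [phi] at time zero. The action law trades [idm T ⊗ phi] for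
    [translation], which commutes with the dynamics and is the identity at time zero; this
    propagates the equation to all times. *)
Lemma flow_comm (X : C) (phi : Hom (T × X) X) :
  phi ∘ translation X = phi ∘ idm T ⊗ phi ->
  fmap F phi ∘ Ldyn S X = dyn (flow_deriv phi) ∘ phi.
Proof.
intros e; simpl.
rewrite !comp_assoc, <- at_zero_nat, <- (comp_assoc (Ldyn S X)), <- Ldyn_nat.
rewrite <- !comp_assoc, <- fmap_comp, <- e, fmap_comp.
rewrite (comp_assoc (fmap F phi)), translation_comm by assumption.
now rewrite !comp_assoc, translation_at_zero, comp_idr.
Qed.

Lemma flow_of_translation (X : C) (phi : Hom (T × X) X) :
  phi ∘ at_zero S X = idm X -> phi ∘ translation X = phi ∘ idm T ⊗ phi ->
  is_flow phi.
Proof.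
intros e0 e; split; [exact e0|].
rewrite <- e; unfold translation; rewrite !comp_assoc; f_equal.
now prod_norm.
Qed.

Context (deriv_unique : forall (X : C) (phi : Hom (T × X) X),
  is_flow phi -> uniqueness_property S (flow_deriv phi)).

Definition translation_mor (X : C) : Hom (Lsys S (T × X)) (Lsys S X) :=
  {| sys_mor := translation X : Hom (carrier (Lsys S _)) (carrier (Lsys S X));
     sys_comm := translation_comm mul_mor X |}.

Lemma Lsys_complete (X : C) : T_complete S (Lfun S X).
Proof.
apply (@T_complete_of_solution (Lsys S X) (translation_mor X)).
- apply translation_at_zero.
(* [Lsys S X] is replaced by the derivative of translation, so that [deriv_unique] applies. *)
- rewrite <- (@flow_deriv_eq (Lsys S X) (translation_mor X)
                (translation_at_zero X)).
  apply deriv_unique, translation_is_flow.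
Qed.

Lemma T_complete_unique (f : Sys F) (hf : T_complete S f) : uniqueness_property S f.
Proof.
intros B g1 g2 e.
destruct (hf B (sys_mor g2 ∘ at_zero S B)) as [g [_ hg]].
now rewrite <- (hg g1 e), <- (hg g2 eq_refl).
Qed.

(** Both composites are morphisms into [g] that restrict to [h] at time zero. *)
Lemma solution_nat (f g : Sys F) (u : uniqueness_property S g)
    (phi : Hom (Lsys S (carrier f)) f) (psi : Hom (Lsys S (carrier g)) g)
    (h : Hom f g) :
  sys_mor phi ∘ at_zero S (carrier f) = idm (carrier f) ->
  sys_mor psi ∘ at_zero S (carrier g) = idm (carrier g) ->
  h ∘ phi = psi ∘ Lmor S (sys_mor h).
Proof.
simpl; intros e1 e2; apply u; simpl.
rewrite !comp_assoc, at_zero_nat, <- (comp_assoc _ (at_zero _ _)), e1, e2.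
now rewrite comp_idl, comp_idr.
Qed.

Lemma flow_deriv_complete (X : C) (phi : Hom (T × X) X) :
  phi ∘ at_zero S X = idm X -> phi ∘ translation X = phi ∘ idm T ⊗ phi ->
  T_complete S (flow_deriv phi).
Proof.
intros e0 e.
apply (@T_complete_of_solution (flow_deriv phi)
  {| sys_mor := phi : Hom (carrier (Lsys S X)) (carrier (flow_deriv phi));
     sys_comm := flow_comm e |}).
- exact e0.
- now apply deriv_unique, flow_of_translation.
Qed.

(** * The adjunction *)

Local Notation L := (corestrict (F := Lfun S) Lsys_complete).
Local Notation U := (forgetT S).

(** Completeness is a proposition, whereas the counit needs actual morphisms; description picks a
    solution, which uniqueness makes canonical. *)
Definition evolution_spec (f : TSys S) :
  {gamma : Hom (Lsys S (U f)) (proj1_sig f) |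
    sys_mor gamma ∘ at_zero S (U f) = idm (U f)}.
Proof.
apply constructive_indefinite_description.
destruct (proj2_sig f (U f) (idm (U f))) as [g [hg _]].
now exists g.
Qed.

Definition evolution (f : TSys S) : Hom (Lsys S (U f)) (proj1_sig f) :=
  proj1_sig (evolution_spec f).

Lemma evolution_at_zero (f : TSys S) :
  sys_mor (evolution f) ∘ at_zero S (U f) = idm (U f).
Proof. exact (proj2_sig (evolution_spec f)). Qed.

Lemma evolution_unique (f : TSys S) (gamma : Hom (Lsys S (U f)) (proj1_sig f)) :
  sys_mor gamma ∘ at_zero S (U f) = idm (U f) -> evolution f = gamma.
Proof.
intros e; apply (T_complete_unique (proj2_sig f)).
now rewrite evolution_at_zero.
Qed.

Lemma evolution_nat (f g : TSys S) (h : Hom (proj1_sig f) (proj1_sig g)) :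
  h ∘ evolution f = evolution g ∘ Lmor S (sys_mor h).
Proof.
apply solution_nat;
  [exact (T_complete_unique (proj2_sig g)) | apply evolution_at_zero ..].
Qed.

Definition adj_eta : NatTrans (Fid C) (Fcomp U L) :=
  {| component := at_zero S : forall X, Hom (Fid C X) (Fcomp U L X);
     naturality := at_zero_nat |}.

Definition adj_eps : NatTrans (Fcomp L U) (Fid (TSys S)) :=
  {| component := evolution : forall f, Hom (Fcomp L U f) (Fid (TSys S) f);
     naturality := evolution_nat |}.

Lemma evolution_triL (X : C) :
  adj_eps (L X) ∘ fmap L (adj_eta X) = idm (L X).
Proof.
apply (T_complete_unique (proj2_sig (L X))); simpl.
rewrite comp_assoc, at_zero_nat, <- comp_assoc.
exact (f_equal (fun k => k ∘ at_zero S X) (evolution_at_zero (L X))).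
Qed.

Definition L_adjunction : Adjunction L U :=
  {| adj_unit := adj_eta; adj_counit := adj_eps;
     adj_triL := evolution_triL; adj_triR := evolution_at_zero |}.

(** * Algebras of the induced monad and monadicity *)

Local Notation EM := (EilenbergMoore (adj_monad L_adjunction)).

(** Identifies the monad multiplication: translation is itself a solution through the identity. *)
Lemma evolution_Lsys (X : C) : sys_mor (evolution (L X)) = translation X.
Proof.
rewrite (@evolution_unique (L X) (translation_mor X)); [reflexivity|].
apply translation_at_zero.
Qed.

Lemma alg_translation (a : EM) :
  (alg_act a : Hom (T × alg_ob a) (alg_ob a)) ∘ translation (alg_ob a)
  = alg_act a ∘ idm T ⊗ (alg_act a).
Proof. rewrite <- evolution_Lsys; exact (alg_mul a). Qed.

Definition deriv_ob (a : EM) : TSys S :=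
  exist (T_complete S) (flow_deriv (alg_act a : Hom (T × alg_ob a) (alg_ob a)))
    (flow_deriv_complete (alg_unit a) (alg_translation a)).

(** An algebra morphism slides past the action, then past the dynamics and evaluation at zero by
    naturality. *)
Lemma deriv_mor_comm (a b : EM) (h : Hom a b) :
  fmap F (am_mor h) ∘ dyn (proj1_sig (deriv_ob a))
  = dyn (proj1_sig (deriv_ob b)) ∘ am_mor h.
Proof.
pose proof (am_comm h) as e; simpl in e |- *.
rewrite <- !comp_assoc, <- fmap_comp, e, fmap_comp.
rewrite (comp_assoc (fmap F _)), Ldyn_nat.
rewrite !comp_assoc; do 2 f_equal; apply at_zero_nat.
Qed.

Definition deriv_mor (a b : EM) (h : Hom a b) : Hom (deriv_ob a) (deriv_ob b) :=
  @Build_SysMor _ _ (proj1_sig (deriv_ob a)) (proj1_sig (deriv_ob b))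
    (am_mor h) (deriv_mor_comm h).

Definition deriv_fun : Functor EM (TSys S).
Proof.
refine {| fobj := deriv_ob; fmap := deriv_mor |}.
- intros a; now apply SysMor_eq.
- intros a b c g f; now apply SysMor_eq.
Defined.

Local Notation K := (comparison L_adjunction).

Lemma deriv_comparison (f : TSys S) :
  dyn (proj1_sig (deriv_ob (K f))) = dyn (proj1_sig f).
Proof. exact (dyn_flow_deriv (evolution_at_zero f)). Qed.

(** By [flow_comm] the action solves its own derivative through the identity, and [evolution] is the
    only such solution. *)
Lemma comparison_deriv (a : EM) : alg_act (K (deriv_ob a)) = alg_act a.
Proof.
refine (f_equal (@sys_mor _ _ _ _) (@evolution_unique (deriv_ob a)
  {| sys_mor := alg_act a : Hom (carrier (Lsys S (alg_ob a))) (U (deriv_ob a));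
     sys_comm := flow_comm (alg_translation a) |} _)).
exact (alg_unit a).
Qed.

(** Systems with equal dynamics are compared by the identity on the carrier, which avoids transport
    along equalities of systems. *)
Lemma id_sys_comm (X : C) (d d' : Hom X (F X)) :
  d = d' -> fmap F (idm X) ∘ d = d' ∘ idm X.
Proof. intros ->; now rewrite fmap_id, comp_idl, comp_idr. Qed.

Lemma id_alg_comm (M : Monad C) (X : C) (a a' : Hom (M X) X) :
  a = a' -> idm X ∘ a = a' ∘ fmap M (idm X).
Proof. intros ->; now rewrite fmap_id, comp_idl, comp_idr. Qed.

Lemma L_adjunction_monadic : monadic L_adjunction.
Proof.
(* Unit and counit are identities on carriers; [deriv_comparison] and [comparison_deriv], each used
   in both directions, make them and their inverses morphisms. *)
unshelve eexists deriv_fun, {| component := fun f => _ |}, {| component := fun a => _ |}.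
- exact (@Build_SysMor _ _ (proj1_sig f) (proj1_sig (deriv_ob (K f)))
           (idm (U f)) (id_sys_comm (eq_sym (deriv_comparison f)))).
- intros f g h; apply SysMor_eq; simpl; now rewrite comp_idl, comp_idr.
- exact (@Build_AlgMor _ (adj_monad L_adjunction) (K (deriv_ob a)) a
           (idm (alg_ob a)) (id_alg_comm (M := adj_monad L_adjunction)
                               (comparison_deriv a))).
- intros a b h; apply AlgMor_eq; simpl; now rewrite comp_idl, comp_idr.
- split.
  + intros f.
    exists (@Build_SysMor _ _ (proj1_sig (deriv_ob (K f))) (proj1_sig f)
              (idm (U f)) (id_sys_comm (deriv_comparison f))).
    split; apply SysMor_eq, comp_idl.
  + intros a.
    exists (@Build_AlgMor _ (adj_monad L_adjunction) a (K (deriv_ob a))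
              (idm (alg_ob a)) (id_alg_comm (M := adj_monad L_adjunction)
                               (eq_sym (comparison_deriv a)))).
    split; apply AlgMor_eq, comp_idl.
Qed.

End Setting.

Theorem corollary6p5 (C : Category) (FP : FiniteProducts C) (F : Functor C C)
    (S : MonoidalSetting F)
    (clock_complete : T_complete S (unit_clock S))
    (mul_mor : mul_is_system_morphism S)
    (deriv_unique : forall (X : C) (phi : Hom (T S × X)%cat X),
        is_flow phi -> uniqueness_property S (flow_deriv phi)) :
  exists (L_complete : forall X : C, T_complete S (Lfun S X))
         (adj : Adjunction (corestrict (F := Lfun S) L_complete) (forgetT S)),
    monadic adj.
Proof.
exists (Lsys_complete mul_mor deriv_unique), (L_adjunction mul_mor deriv_unique).
apply L_adjunction_monadic.
Qed.
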